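(* Let $T\ge 1$ and assume that for all $t\in\{1,\dots,T\}$ we have $1\le|\mathcal A_t|<\infty$ and $r_t(i),\hat r_t(i),b_t(i)\in[0,1]$ for all $i\in\mathcal A_t$, and that there is $\omega>0$ with $\mathrm{OPT}_T\ge\omega T$. If $\alpha=0$ (so that the robust learning-augmented policy is the advice-only policy $\mathrm{ADV}$), then $$\mathrm{CR}_T(\mathrm{ADV})\ge 1-\frac{2\varepsilon_T}{\omega}.$$ In particular, if $\varepsilon_T=0$ then the advice-only policy is offline-optimal, i.e. $W_T(\mathrm{ADV})=\mathrm{OPT}_T$.
   Context: Fix a horizon $T\in\mathbb N$, $T\ge1$, and a set of items $\mathcal I$. At each time $t\in\{1,\dots,T\}$ there is a finite feasible slate $\mathcal A_t\subseteq\mathcal I$, a reward function $r_t:\mathcal A_t\to\mathbb R$, a learned advice score $\hat r_t:\mathcal A_t\to\mathbb R$ and a conservative fallback score $b_t:\mathcal A_t\to\mathbb R$. The sequence $(\mathcal A_t,r_t,\hat r_t,b_t)_{t=1}^T$ is fixed (deterministic). A policy $\pi$ chooses $a_t^\pi\in\mathcal A_t$ at each $t$. Definitions: $W_T(\pi)=\sum_{t=1}^T r_t(a_t^\pi)$; $\mathrm{OPT}_T=\sum_{t=1}^T\max_{i\in\mathcal A_t}r_t(i)$; $\mathrm{CR}_T(\pi)=W_T(\pi)/\mathrm{OPT}_T$ whenever $\mathrm{OPT}_T>0$. For a function $f$ on $\mathcal A_t$, $\|f\|_{\infty,\mathcal A_t}=\max_{i\in\mathcal A_t}|f(i)|$.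 Average advice error: $\varepsilon_T=\frac1T\sum_{t=1}^T\|\hat r_t-r_t\|_{\infty,\mathcal A_t}$. For $\alpha\in[0,1]$ the robust learning-augmented policy selects an action in $\arg\max_{i\in\mathcal A_t}\{(1-\alpha)\hat r_t(i)+\alpha b_t(i)\}$. The advice-only policy ADV selects any $a_t^{\mathrm{ADV}}\in\arg\max_{i\in\mathcal A_t}\hat r_t(i)$ (arbitrary tie-breaking). *)

(* Defs.v *)
From HB Require Import structures.
From mathcomp Require Import all_boot all_order all_algebra finmap reals.

Set Implicit Arguments.
Unset Strict Implicit.
Unset Printing Implicit Defensive.

Import Order.TTheory GRing.Theory Num.Theory.

Local Open Scope ring_scope.

(* Total version of max_{x in X} f x: the value is the default 0 when X is
   empty. *)
Definition fmax (R : realType) (X : finType) (f : X -> R) : R :=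
  if [pick x : X] is Some x0 then f [arg max_(x > x0) f x]%O else 0.

Definition sup_norm (R : realType) (X : finType) (f : X -> R) : R :=
  fmax (fun x => `|f x|).

Definition is_argmax (R : realType) (X : finType) (f : X -> R) (x : X) : Prop :=
  forall y : X, f y <= f x.

(* Times 1, ..., T are indexed by 'I_T. The slate at time t is the finite set
   A t, and scores at time t are functions on (the subtype of) A t only. *)
Definition scores (R : realType) (I : choiceType) (T : nat)
  (A : 'I_T -> {fset I}) : Type := forall t : 'I_T, A t -> R.

Definition policy (I : choiceType) (T : nat) (A : 'I_T -> {fset I}) : Type :=
  forall t : 'I_T, A t.

Definition welfare (R : realType) (I : choiceType) (T : nat)
  (A : 'I_T -> {fset I}) (r : scores R A) (a : policy A) : R :=
  \sum_(t < T) r t (a t).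

Definition OPT (R : realType) (I : choiceType) (T : nat)
  (A : 'I_T -> {fset I}) (r : scores R A) : R :=
  \sum_(t < T) fmax (r t).

(* Meaningful only when OPT r > 0. *)
Definition CR (R : realType) (I : choiceType) (T : nat)
  (A : 'I_T -> {fset I}) (r : scores R A) (a : policy A) : R :=
  welfare r a / OPT r.

Definition advice_error (R : realType) (I : choiceType) (T : nat)
  (A : 'I_T -> {fset I}) (r rhat : scores R A) : R :=
  T%:R^-1 * \sum_(t < T) sup_norm (fun i : A t => rhat t i - r t i).

(* Tie-breaking is arbitrary: these are predicates satisfied by every policy
   that picks some maximizer at each time. *)
Definition is_robust_policy (R : realType) (I : choiceType) (T : nat)
  (A : 'I_T -> {fset I}) (rhat b : scores R A) (alpha : R) (a : policy A)
  : Prop :=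
  forall t : 'I_T,
    is_argmax (fun i : A t => (1 - alpha) * rhat t i + alpha * b t i) (a t).

Definition is_ADV (R : realType) (I : choiceType) (T : nat)
  (A : 'I_T -> {fset I}) (rhat : scores R A) (a : policy A) : Prop :=
  forall t : 'I_T, is_argmax (rhat t) (a t).

(* Main.v *)
(* If x maximizes the advice g and y maximizes the reward f, then
   f y - f x <= (f y - g y) + (g x - f x) <= 2 * |g - f|. Summing over time
   bounds the regret OPT - W by 2 * T * eps, and OPT >= omega * T turns this
   into the bound on the ratio. *)
Require Import Defs.
From mathcomp Require Import all_boot all_order all_algebra finmap reals.
From mathcomp Require Import lra.

Set Implicit Arguments.
Unset Strict Implicit.
Unset Printing Implicit Defensive.

Import Order.TTheory GRing.Theory Num.Theory.

Local Open Scope ring_scope.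

Section Fmax.
Variables (R : realType) (X : finType).
Implicit Types (f g : X -> R) (x : X).

(** The point [x] witnesses that [X] is inhabited, which excludes the default branch of [fmax]. *)
Lemma fmax_attained f x : exists2 y, fmax f = f y & is_argmax f y.
Proof.
rewrite /fmax; case: pickP => [x0 _|/(_ x)//].
by case: arg_maxP => // y _ ymax; exists y => // z; apply: ymax.
Qed.

Lemma le_fmax f x : f x <= fmax f.
Proof. by have [y -> ymax] := fmax_attained f x. Qed.

Lemma le_sup_norm f x : `|f x| <= sup_norm f.
Proof. exact: (le_fmax (fun x => `|f x|)). Qed.

Lemma argmax_regret f g x :
  is_argmax g x -> fmax f - f x <= 2 * sup_norm (fun i => g i - f i).
Proof.
move=> xmax; have [y -> _] := fmax_attained f x.
have := le_sup_norm (fun i => g i - f i) x.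
have := le_sup_norm (fun i => g i - f i) y.
(* One side of each bound suffices: the advice may undervalue [y] and overvalue [x], each by at most
   the norm. *)
rewrite !ler_norml => /andP[lo_y _] /andP[_ hi_x].
have := xmax y; lra.
Qed.

End Fmax.

Section Regret.
Variables (R : realType) (I : choiceType) (T : nat) (A : 'I_T -> {fset I}).
Implicit Types (r rhat b : scores R A) (a : policy A).

Lemma robust_policy0 rhat b a :
  is_robust_policy rhat b 0 a <-> is_ADV rhat a.
Proof.
by split=> amax t i; have := amax t i; rewrite /= subr0 !mul1r !mul0r !addr0.
Qed.

Lemma welfare_le_OPT r a : welfare r a <= OPT r.
Proof. by apply: ler_sum => t _; apply: le_fmax. Qed.

(** The policy [a] supplies a point of each slate, where the norm dominates an absolute value. *)
Lemma advice_error_ge0 r rhat a : 0 <= advice_error r rhat.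
Proof.
rewrite mulr_ge0 ?invr_ge0// sumr_ge0// => t _.
exact: le_trans (normr_ge0 _) (le_sup_norm _ (a t)).
Qed.

Lemma ADV_regret r rhat a : (0 < T)%N -> is_ADV rhat a ->
  OPT r - welfare r a <= 2 * (T%:R * advice_error r rhat).
Proof.
(* Since [T] is nonzero, it cancels the averaging factor and leaves a termwise comparison of
   sums. *)
move=> T_gt0 amax; rewrite /advice_error mulVKf ?pnatr_eq0 -?lt0n//.
rewrite mulr_sumr /OPT /welfare -sumrB.
by apply: ler_sum => t _; apply: argmax_regret.
Qed.

End Regret.

Theorem corollary2 (R : realType) (I : choiceType) (T : nat)
  (A : 'I_T -> {fset I}) (r rhat b : scores R A) (omega alpha : R)
  (hT : (1 <= T)%N)
  (hA : forall t : 'I_T, (1 <= #|` A t|)%N)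
  (hr : forall (t : 'I_T) (i : A t), 0 <= r t i <= 1)
  (hrhat : forall (t : 'I_T) (i : A t), 0 <= rhat t i <= 1)
  (hb : forall (t : 'I_T) (i : A t), 0 <= b t i <= 1)
  (homega : 0 < omega)
  (hOPT : omega * T%:R <= OPT r)
  (halpha : alpha = 0) :
  (forall a : policy A, is_robust_policy rhat b alpha a <-> is_ADV rhat a) /\
  (forall a : policy A, is_ADV rhat a ->
     1 - 2 * advice_error r rhat / omega <= CR r a /\
     (advice_error r rhat = 0 -> welfare r a = OPT r)).
Proof.
split=> [a|a aADV]; first by rewrite halpha; apply: robust_policy0.
have regret := ADV_regret r hT aADV.
have err_ge0 := advice_error_ge0 r rhat a.
split; last first.
  (* Zero error makes the regret nonpositive. *)
  move=> err0; apply/eqP; rewrite eq_le welfare_le_OPT /=.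
  by rewrite -subr_le0 (le_trans regret)// err0 !mulr0.
have OPT_gt0 : 0 < OPT r by rewrite (lt_le_trans _ hOPT)// mulr_gt0 ?ltr0n.
(* Clearing the denominator turns the goal into an upper bound [2 * eps / omega * OPT r] on the
   regret. *)
rewrite /CR ler_pdivlMr// mulrBl mul1r lerBlDr -lerBlDl.
apply: le_trans regret _.
move: (advice_error r rhat) err_ge0 => eps eps_ge0.
rewrite -!mulrA ler_pM2l//.
(* As [eps] is nonnegative, it remains to see that [T] is at most [OPT r / omega], which is
   [hOPT]. *)
by rewrite [leLHS]mulrC; apply: ler_wpM2l; rewrite // ler_pdivlMl.
Qed.
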